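(* Let $T$ be a regular interval exchange transformation on the alphabet $A$. For $\chi\in\{\varphi,\psi\}^*$, let $S=\chi(T)$ and let $I$ be the domain of $S$. There exists an automorphism $\theta$ of the free group on $A$ such that $\Sigma_T(z)=\theta(\Sigma_S(z))$ for all $z\in I$.
   Context: An $s$-interval exchange transformation $T$ on $[\ell,r[$ over a finite alphabet $A=\{a_1<_1\cdots<_1a_s\}$ equipped also with a second total order $<_2$ is given by a partition $(I_a)_{a\in A}$ of $[\ell,r[$ into semi-intervals $I_a=[\gamma_a,\mu_a[$ (sets $[\alpha,\beta[=\{z:\alpha\le z<\beta\}$) of lengths $\lambda_a>0$ placed left to right in the order $<_1$; with $\nu_a=\ell+\sum_{b\le_2a}\lambda_b$, $T(z)=z+\nu_a-\mu_a$ on $I_a$, mapping $I_a$ onto $J_a=[\delta_a,\nu_a[$. $T$ is regular if the orbits of $\gamma_{a_2},\dots,\gamma_{a_s}$ are infinite and pairwise disjoint; regular implies minimal. The natural coding of $T$ at $z$ is $\Sigma_T(z)=c_0c_1\cdots$ with $c_n=a$ iff $T^n(z)\in I_a$; an automorphism $\theta$ of the free group which maps letters to positive words acts on infinite words letterwise. For minimal $T$ and a semi-interval $I$, the induced transformation on $I$ is $S(z)=T^n(z)$, $n=\min\{n>0:T^n(z)\in I\}$. Rauzy inductions, with $b_{\max},b_{\min}$ the $<_2$-largest/smallest letters: $\psi(T)$ is the transformation $S$ induced by $T$ on $Z(T)=[\ell,\max\{\gamma_{a_s},\delta_{b_{\max}}\}[$; it is an $s$-interval exchange transformation on the alphabet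 $A$ whose semi-interval labelled $a$ is $K_a=I_a\cap Z(T)$ if $\gamma_{a_s}<\delta_{b_{\max}}$, and $K_a=S^{-1}(T(I_a)\cap Z(T))$ if $\gamma_{a_s}>\delta_{b_{\max}}$. The left induction $\varphi(T)$ is the transformation $S$ induced on $Y(T)=[\min\{\mu_{a_1},\nu_{b_{\min}}\},r[$, labelled symmetrically: $K_a=I_a\cap Y(T)$ if $\nu_{b_{\min}}<\mu_{a_1}$, and $K_a=S^{-1}(T(I_a)\cap Y(T))$ otherwise. Both are again regular $s$-interval exchange transformations on $A$, so they can be iterated; for $\chi=\chi_1\cdots\chi_n\in\{\varphi,\psi\}^*$, $\chi(T)=\chi_1(\cdots\chi_n(T)\cdots)$, $\chi(T)=T$ for empty $\chi$. $\Sigma_S$ is the natural coding of $S$ with respect to this labelling. *)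

(* Defs.v *)
From HB Require Import structures.
From mathcomp Require Import all_boot all_order all_algebra.
From mathcomp Require Import all_classical all_reals.

Set Implicit Arguments.
Unset Strict Implicit.
Unset Printing Implicit Defensive.

Import Order.TTheory GRing.Theory Num.Theory.

(** * The free group on a finite alphabet

    Elements are reduced words over signed letters: [(a, true)] stands for the
    letter [a] and [(a, false)] for its inverse. *)

Section FreeGroup.
Variable A : finType.
Implicit Types (x y : A * bool) (s t : seq (A * bool)).

Definition sinv x : A * bool := (x.1, ~~ x.2).

Definition reduced s := sorted (fun x y => y != sinv x) s.

Definition cons_red x s :=
  if s is y :: s' then if y == sinv x then s' else x :: s else [:: x].

Lemma sinvK : involutive sinv.
Proof. by case=> a b; rewrite /sinv /= negbK. Qed.

Lemma cons_red_reduced x s : reduced s -> reduced (cons_red x s).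
Proof.
case: s => [|y s] //= pys; case: ifP => [_|/negbT nyx].
  exact: (path_sorted pys).
by rewrite /reduced /= nyx.
Qed.

Lemma foldr_reduced s t : reduced t -> reduced (foldr cons_red t s).
Proof. by move=> rt; elim: s => //= x s; apply: cons_red_reduced. Qed.

Lemma cons_redK x s : reduced s -> cons_red x (cons_red (sinv x) s) = s.
Proof.
case: s => [|y s] /=; first by rewrite eqxx.
rewrite sinvK; case: eqP => [->|_ _] /=; last by rewrite eqxx.
by case: s => [|z s] //= /andP[/negbTE-> _].
Qed.

Lemma foldr_cons_red x s t : reduced t ->
  foldr cons_red t (cons_red x s) = cons_red x (foldr cons_red t s).
Proof.
move=> rt; case: s => [|y s] //=; case: eqP => [->|] //.
by rewrite cons_redK //; apply: foldr_reduced.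
Qed.

Lemma foldrA s t u : reduced u ->
  foldr cons_red u (foldr cons_red t s) =
  foldr cons_red (foldr cons_red u t) s.
Proof. by move=> ru; elim: s => //= x s IHs; rewrite foldr_cons_red ?IHs. Qed.

Lemma foldr_nil s : reduced s -> foldr cons_red [::] s = s.
Proof.
elim: s => //= x s IHs pxs; rewrite IHs; last exact: (path_sorted pxs).
by case: s pxs {IHs} => //= y s /andP[/negbTE-> _].
Qed.

Record free_group := FreeGroup { word : seq (A * bool); _ : reduced word }.

HB.instance Definition _ := [isSub for word].
HB.instance Definition _ := [Choice of free_group by <:].

Implicit Types u v w : free_group.

Lemma word_reduced u : reduced (word u). Proof. by case: u. Qed.

Definition fg_one := @FreeGroup [::] isT.

Definition fg_mul u v :=
  FreeGroup (foldr_reduced (word u) (word_reduced v)).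

Lemma reduced_inv s : reduced s -> reduced (rev (map sinv s)).
Proof.
rewrite /reduced rev_sorted sorted_map; apply: sub_sorted => x y /=.
by rewrite sinvK; apply: contra => /eqP->.
Qed.

Definition fg_inv u := FreeGroup (reduced_inv (word_reduced u)).

Lemma fg_mulA : associative fg_mul.
Proof. by move=> u v w; apply/val_inj; rewrite /= foldrA ?word_reduced. Qed.

Lemma fg_mul1 : left_id fg_one fg_mul.
Proof. by move=> u; apply/val_inj. Qed.

Lemma fg_mulr1 : right_id fg_one fg_mul.
Proof. by move=> u; apply/val_inj; rewrite /= foldr_nil ?word_reduced. Qed.

Lemma fg_mulV : left_inverse fg_one fg_inv fg_mul.
Proof.
move=> u; apply/val_inj => /=.
elim: (word u) (word_reduced u) => //= x s IHs pxs.
have rs : reduced s := path_sorted pxs.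
rewrite rev_cons foldr_rcons /= -[RHS](IHs rs); congr foldr.
by case: s pxs {IHs rs} => [|y s] /=; rewrite sinvK eqxx.
Qed.

Lemma fg_mulrV : right_inverse fg_one fg_inv fg_mul.
Proof.
move=> u; rewrite -[LHS]fg_mul1 -{1}(fg_mulV (fg_inv u)) -fg_mulA.
by rewrite [X in fg_mul _ X]fg_mulA fg_mulV fg_mul1 fg_mulV.
Qed.

HB.instance Definition _ := isGroup.Build free_group
  fg_mulA fg_mul1 fg_mulr1 fg_mulV fg_mulrV.

Definition fg_letter (a : A) : free_group := @FreeGroup [:: (a, true)] isT.

Definition positive_elt u := all snd (word u).

(** Images of letters under [theta], as words over [A]; meaningful when these
    images are positive. *)
Definition letter_image (theta : free_group -> free_group) (a : A) : seq A :=
  map fst (word (theta (fg_letter a))).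

(** [theta(c_0) theta(c_1) ...]: an automorphism sends no letter to the empty
    word, so [theta(c_0) ... theta(c_n)] has more than [n] letters and the
    default value of [nth] is not reached. *)
Definition apply_inf (theta : free_group -> free_group) (c : nat -> A) :
    nat -> A :=
  fun n => nth (c 0) (flatten [seq letter_image theta (c i) | i <- iota 0 n.+1]) n.

Definition positive_automorphism (theta : {multiplicative free_group -> free_group}) :=
  bijective theta /\ forall a, positive_elt (theta (fg_letter a)).

End FreeGroup.

Local Open Scope ring_scope.
Local Open Scope classical_set_scope.

(** * Interval exchange transformations *)

Definition total_order (A : Type) (le : rel A) : Prop :=
  [/\ reflexive le, antisymmetric le, transitive le & total le].

Record iet (R : realType) (A : finType) := IET {
  card_alphabet : (0 < #|A|)%N;
  left_end : R;
  len : A -> R;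
  le1 : rel A;
  le2 : rel A;
  len_gt0 : forall a, 0 < len a;
  le1_order : total_order le1;
  le2_order : total_order le2 }.

Section IntervalExchange.
Variables (R : realType) (A : finType).
Implicit Types (T S : iet R A) (a b : A) (z : R) (E : set R).

Definition right_end T : R := left_end T + \sum_a len T a.

Definition domain T : set R := `[left_end T, right_end T[.

Definition mu T a : R := left_end T + \sum_(b | le1 T b a) len T b.
Definition gamma T a : R := left_end T + \sum_(b | le1 T b a && (b != a)) len T b.
Definition nu T a : R := left_end T + \sum_(b | le2 T b a) len T b.
Definition delta T a : R := left_end T + \sum_(b | le2 T b a && (b != a)) len T b.

(** The semi-interval [I_a]. *)
Definition piece T a : set R := `[gamma T a, mu T a[.

(** An arbitrary letter, used as a default where no letter is found. *)
Definition any_letter T : A := enum_val (Ordinal (card_alphabet T)).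

(** The letter [a] with [z] in [I_a], for [z] in the domain. *)
Definition label T z : A :=
  odflt (any_letter T) [pick a | gamma T a <= z < mu T a].

(** The transformation itself, extended by the identity outside its domain. *)
Definition iet_fun T z : R :=
  if (left_end T <= z < right_end T)
  then z + nu T (label T z) - mu T (label T z) else z.

(** [{T^n(z) | n integer}]: as [T] is injective, [T^(-n)(z) = y] is
    [T^n(y) = z]. *)
Definition iet_orbit T z : set R :=
  [set y | exists n, iter n (iet_fun T) z = y \/ iter n (iet_fun T) y = z].

Definition largest_letter T (le : rel A) : A :=
  odflt (any_letter T) [pick a | [forall b, le b a]].
Definition smallest_letter T (le : rel A) : A :=
  odflt (any_letter T) [pick a | [forall b, le a b]].

Definition regular T : Prop :=
  let D := [set a | a <> smallest_letter T (le1 T)] in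
  (forall a, D a -> infinite_set (iet_orbit T (gamma T a))) /\
  trivIset D (fun a => iet_orbit T (gamma T a)).

(** [Sigma_T(z)], for [z] in the domain. *)
Definition coding T z : nat -> A := fun n => label T (iter n (iet_fun T) z).

Definition first_return T E z (n : nat) : Prop :=
  [/\ (0 < n)%N, E (iter n (iet_fun T) z) &
      forall m, (0 < m < n)%N -> ~ E (iter m (iet_fun T) z)].

Definition is_induced T E S : Prop :=
  domain S = E /\
  forall z, E z -> exists2 n, first_return T E z n & iet_fun S z = iter n (iet_fun T) z.

(** ** Rauzy inductions

    [is_psi T S] and [is_phi T S] read [S = psi(T)] and [S = phi(T)]. A
    transformation [S] is determined by its domain, its map and its labelled
    semi-intervals; its two orders are those of the semi-intervals and of their
    images. The endpoints compared below are distinct when [T] is regular and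
    the alphabet has at least two letters. *)

Definition is_psi T S : Prop :=
  let g := gamma T (largest_letter T (le1 T)) in
  let d := delta T (largest_letter T (le2 T)) in
  let Z : set R := (`[left_end T, Num.max g d[)%classic in
  is_induced T Z S /\
  forall a, piece S a =
    if g < d then piece T a `&` Z
    else Z `&` (iet_fun S @^-1` ((iet_fun T @` (piece T a)) `&` Z)).

Definition is_phi T S : Prop :=
  let m := mu T (smallest_letter T (le1 T)) in
  let n := nu T (smallest_letter T (le2 T)) in
  let Y : set R := (`[Num.min m n, right_end T[)%classic in
  is_induced T Y S /\
  forall a, piece S a =
    if n < m then piece T a `&` Y
    else Y `&` (iet_fun S @^-1` ((iet_fun T @` (piece T a)) `&` Y)).

End IntervalExchange.

Inductive rauzy := Phi | Psi.

(** [S = chi(T)], where the rightmost letter of [chi] acts first. *)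
Fixpoint is_rauzy (R : realType) (A : finType) (chi : seq rauzy)
    (T S : iet R A) : Prop :=
  match chi with
  | [::] => S = T
  | c :: chi' => exists2 T', is_rauzy chi' T T' &
      match c with Phi => is_phi T' S | Psi => is_psi T' S end
  end.

(* Main.v *)
(** One Rauzy step removes from the domain a semi-interval contained in both
    [I_a] and [T(I_b)] (for [psi], [a] is [<_1]-largest and [b] is
    [<_2]-largest) and equal to one of them. A point of the new domain leaves it
    only when coming from [I_b], then lies in [I_a] and returns at the second
    step, as [a <> b] makes [T(I_a)] disjoint from [T(I_b)]. Hence the coding is
    recovered by [b |-> b a] or by [a |-> b a], according to the labelling,
    and such substitutions compose. *)

From HB Require Import structures.
Require Import Defs.
From mathcomp Require Import all_boot all_order all_algebra.
From mathcomp Require Import all_classical all_reals.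
From mathcomp Require Import ring lra.

Set Implicit Arguments.
Unset Strict Implicit.
Unset Printing Implicit Defensive.

Import Order.TTheory GRing.Theory Num.Theory.

(** * Endomorphisms of the free group and positive words *)

Section FreeGroupMorphisms.
Variable A : finType.
Implicit Types (x : A * bool) (s t : seq (A * bool)) (a b c : A).
Implicit Types (u v : free_group A) (f g : A -> free_group A).
Local Open Scope group_scope.

Definition signed_value f x : free_group A := if x.2 then f x.1 else (f x.1)^-1.

Definition word_value f s : free_group A := \prod_(x <- s) signed_value f x.

(** The endomorphism that the universal property of the free group attaches to [f]. *)
Definition fg_ext f u := word_value f (word u).

Lemma signed_value_sinv f x : signed_value f (sinv x) = (signed_value f x)^-1.
Proof. by case: x => a [] //; rewrite /signed_value /= invgK. Qed.

(** A cancelled pair contributes a product of two inverses, so evaluation does not see free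
    reduction; this makes [fg_ext f] a morphism. *)
Lemma word_value_cons_red f x s :
  word_value f (cons_red x s) = signed_value f x * word_value f s.
Proof.
rewrite /word_value; case: s => [|y s] /=; first by rewrite big_cons.
case: eqP => [->|_]; last by rewrite big_cons.
by rewrite big_cons signed_value_sinv mulgA mulgV mul1g.
Qed.

Lemma fg_extM f : {morph fg_ext f : u v / u * v}.
Proof.
move=> u v; rewrite /fg_ext /=; elim: (word u) => [|x s IHs] /=.
  by rewrite /word_value big_nil mul1g.
by rewrite word_value_cons_red IHs /word_value big_cons mulgA.
Qed.

HB.instance Definition _ f :=
  isMultiplicative.Build (free_group A) (free_group A) (fg_ext f) (@fg_extM f).

Lemma fg_ext_letter f a : fg_ext f (fg_letter a) = f a.
Proof. by rewrite /fg_ext /word_value big_seq1. Qed.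

Lemma morph_fg1 (h : free_group A -> free_group A) :
  {morph h : u v / u * v} -> h 1 = 1.
Proof. by move=> hM; apply: (mulgI (h 1)); rewrite -hM !mulg1. Qed.

Lemma morph_fgV (h : free_group A -> free_group A) u :
  {morph h : u v / u * v} -> h u^-1 = (h u)^-1.
Proof.
by move=> hM; apply: (mulgI (h u)); rewrite -hM !mulgV (morph_fg1 hM).
Qed.

Lemma word_value_letter s : reduced s -> word (word_value (@fg_letter A) s) = s.
Proof.
(* Writing the right side as the reduction of [s] gives a claim valid for all words, which suits the
   induction. *)
move=> rs; rewrite -[RHS](foldr_nil rs) {rs}.
elim: s => [|[a e] s IHs] /=; first by rewrite /word_value big_nil.
by rewrite /word_value big_cons -IHs; case: e.
Qed.

Lemma fg_ext_id u : fg_ext (@fg_letter A) u = u.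
Proof. by apply/val_inj; rewrite /= word_value_letter ?word_reduced. Qed.

Lemma fg_ext_comp (h : free_group A -> free_group A) f u :
  {morph h : u v / u * v} -> h (fg_ext f u) = fg_ext (h \o f) u.
Proof.
move=> hM; rewrite /fg_ext /word_value (big_morph h hM (morph_fg1 hM)).
by apply: eq_bigr => -[a []] _; rewrite /signed_value //= morph_fgV.
Qed.

(** Endomorphisms that agree on letters coincide, so a one-sided inverse can be checked on
    letters. *)
Lemma fg_ext_cancel f g :
  (forall a, fg_ext g (f a) = fg_letter a) -> cancel (fg_ext f) (fg_ext g).
Proof.
move=> gf u; rewrite fg_ext_comp; last exact: fg_extM.
by rewrite -[RHS]fg_ext_id; apply: eq_bigr => -[a e] _; rewrite /signed_value /= gf.
Qed.

(** Cancellation requires adjacent letters of opposite signs, and these never meet here. *)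
Lemma word_mul_positive u v : positive_elt u -> positive_elt v ->
  word (u * v) = word u ++ word v.
Proof.
rewrite /positive_elt /= => pu pv; elim: (word u) pu => //= x s IHs /andP[px ps].
rewrite IHs //; have : all snd (s ++ word v) by rewrite all_cat ps.
case: (s ++ word v) => //= y t.
by case: eqP => // -> /=; rewrite px.
Qed.

Lemma positive_eltM u v : positive_elt u -> positive_elt v -> positive_elt (u * v).
Proof.
by move=> pu pv; rewrite /positive_elt (word_mul_positive pu pv) all_cat; apply/andP.
Qed.

Definition positive_word u := map fst (word u).

(** Expand [u] as a product of letters: their images are positive, hence multiply by plain
    concatenation. *)
Lemma positive_morph (h : free_group A -> free_group A) u :
    {morph h : u v / u * v} -> (forall a, positive_elt (h (fg_letter a))) ->
    positive_elt u ->
  positive_elt (h u) /\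
  positive_word (h u) = flatten (map (letter_image h) (positive_word u)).
Proof.
move=> hM hp pu; rewrite -[u]fg_ext_id fg_ext_comp // [in RHS]fg_ext_id.
rewrite /positive_word /fg_ext /word_value.
elim: (word u) (pu : all snd (word u)) => {u pu} [|[a e] s IHs] /=.
  by rewrite big_nil.
case: e => //= /IHs[ps es]; rewrite big_cons; split.
  exact: (positive_eltM (hp a)).
by rewrite (word_mul_positive (hp a)) // map_cat es.
Qed.

Lemma letter_image_comp (h k : {multiplicative free_group A -> free_group A}) a :
    positive_automorphism h -> positive_automorphism k ->
  letter_image (h \o k) a = flatten (map (letter_image h) (letter_image k a)).
Proof.
by move=> [_ hp] [_ kp]; case: (positive_morph (@gmulfM _ _ h) hp (kp a)).
Qed.

Lemma positive_automorphism_comp (h k : {multiplicative free_group A -> free_group A}) :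
    positive_automorphism h -> positive_automorphism k ->
  positive_automorphism (h \o k : {multiplicative free_group A -> free_group A}).
Proof.
move=> [hb hp] [kb kp]; split; first exact: bij_comp.
by move=> a; case: (positive_morph (@gmulfM _ _ h) hp (kp a)).
Qed.

(** By injectivity, a letter cannot share the image of the identity. *)
Lemma letter_image_neq_nil (h : {multiplicative free_group A -> free_group A}) a :
  positive_automorphism h -> letter_image h a != [::].
Proof.
move=> [/bij_inj hI _]; apply/eqP => ha0.
suff: fg_letter a = 1 by move/(congr1 (@word A)).
apply: hI; rewrite (morph_fg1 (@gmulfM _ _ h)); apply/val_inj.
by move: ha0; rewrite /letter_image /=; case: (word _).
Qed.

(** Keeps the index of [nth] in [apply_inf] in range, so that its default value is never read. *)
Lemma leq_size_letter_images (h : {multiplicative free_group A -> free_group A})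
    (w : seq A) : positive_automorphism h ->
  (size w <= size (flatten (map (letter_image h) w)))%N.
Proof.
move=> hP; elim: w => //= a w IHw.
by rewrite size_cat -add1n leq_add // lt0n size_eq0 letter_image_neq_nil.
Qed.

Lemma positive_word2 a b : positive_word (fg_letter b * fg_letter a) = [:: b; a].
Proof. by rewrite /positive_word word_mul_positive. Qed.

Lemma fg_ext_automorphism f g :
    (forall a, fg_ext g (f a) = fg_letter a) ->
    (forall a, fg_ext f (g a) = fg_letter a) ->
    (forall a, positive_elt (f a)) ->
  exists2 theta : {multiplicative free_group A -> free_group A},
    positive_automorphism theta &
    forall a, letter_image theta a = positive_word (f a).
Proof.
move=> gf fg fp; exists (fg_ext f : {multiplicative free_group A -> free_group A}).
  split; first by exists (fg_ext g); apply: fg_ext_cancel.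
  by move=> a; rewrite /= fg_ext_letter.
by move=> a; rewrite /letter_image /= fg_ext_letter.
Qed.

(** The substitution [a |-> b a] is inverted by [a |-> b^-1 a], since both fix [b]. *)
Lemma prepend_automorphism a b : a != b ->
  exists2 theta : {multiplicative free_group A -> free_group A},
    positive_automorphism theta &
    forall c, letter_image theta c = if c == a then [:: b; a] else [:: c].
Proof.
move=> /negbTE ab; have ba : (b == a) = false by rewrite eq_sym.
pose f c := if c == a then fg_letter b * fg_letter a else fg_letter c.
pose g c := if c == a then (fg_letter b)^-1 * fg_letter a else fg_letter c.
have gf c : fg_ext g (f c) = fg_letter c.
  rewrite /f; case: eqP => [->|/eqP/negbTE ca].
    by rewrite fg_extM !fg_ext_letter /g ba eqxx mulVKg.
  by rewrite fg_ext_letter /g ca.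
have fg c : fg_ext f (g c) = fg_letter c.
  rewrite /g; case: eqP => [->|/eqP/negbTE ca].
    by rewrite fg_extM (morph_fgV _ (@fg_extM f)) !fg_ext_letter /f ba eqxx mulKg.
  by rewrite fg_ext_letter /f ca.
have [c|theta thetaP thetaE] := fg_ext_automorphism gf fg.
  by rewrite /f; case: eqP => // _; apply: positive_eltM.
by exists theta => // c; rewrite thetaE /f; case: eqP => // _; rewrite positive_word2.
Qed.

(** The substitution [b |-> b a] is inverted by [b |-> b a^-1], since both fix [a]. *)
Lemma append_automorphism a b : a != b ->
  exists2 theta : {multiplicative free_group A -> free_group A},
    positive_automorphism theta &
    forall c, letter_image theta c = if c == b then [:: b; a] else [:: c].
Proof.
move=> /negbTE ab.
pose f c := if c == b then fg_letter b * fg_letter a else fg_letter c.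
pose g c := if c == b then fg_letter b * (fg_letter a)^-1 else fg_letter c.
have gf c : fg_ext g (f c) = fg_letter c.
  rewrite /f; case: eqP => [->|/eqP/negbTE ca].
    by rewrite fg_extM !fg_ext_letter /g ab eqxx mulgVK.
  by rewrite fg_ext_letter /g ca.
have fg c : fg_ext f (g c) = fg_letter c.
  rewrite /g; case: eqP => [->|/eqP/negbTE ca].
    by rewrite fg_extM (morph_fgV _ (@fg_extM f)) !fg_ext_letter /f ab eqxx mulgK.
  by rewrite fg_ext_letter /f ca.
have [c|theta thetaP thetaE] := fg_ext_automorphism gf fg.
  by rewrite /f; case: eqP => // _; apply: positive_eltM.
by exists theta => // c; rewrite thetaE /f; case: eqP => // _; rewrite positive_word2.
Qed.

End FreeGroupMorphisms.

Local Open Scope ring_scope.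
Local Open Scope classical_set_scope.

(** * Semi-intervals stacked along a total order *)

Lemma ler_sum_pred (R : realType) (A : finType) (P Q : pred A) (F : A -> R) :
    (forall a, 0 <= F a) -> (forall a, P a -> Q a) ->
  \sum_(a | P a) F a <= \sum_(a | Q a) F a.
Proof.
move=> F0 PQ; rewrite [leLHS]big_mkcond [leRHS]big_mkcond; apply: ler_sum => a _.
by case: ifP => [/PQ ->//|_]; case: ifP.
Qed.

(** Endpoints of intervals of lengths [len] placed left to right from [lo] in
    the order [le]; [gamma], [mu] and [delta], [nu] are instances. *)
Definition stacked_lower (R : realType) (A : finType) (le : rel A) (lo : R)
  (len : A -> R) a := lo + \sum_(b | le b a && (b != a)) len b.
Definition stacked_upper (R : realType) (A : finType) (le : rel A) (lo : R)
  (len : A -> R) a := lo + \sum_(b | le b a) len b.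

Section TotalOrder.
Variables (A : finType) (le : rel A).
Hypothesis le_order : total_order le.

Let le_refl : reflexive le. Proof. by case: le_order. Qed.
Let le_anti : antisymmetric le. Proof. by case: le_order. Qed.
Let le_trans : transitive le. Proof. by case: le_order. Qed.
Let le_total : total le. Proof. by case: le_order. Qed.

Lemma total_order_max (P : pred A) a0 : P a0 ->
  exists2 a, P a & forall b, P b -> le b a.
Proof.
move=> Pa0; pose ge x y := le y x.
have ge_trans : transitive ge by move=> y x z yx zy; apply: le_trans zy yx.
have ge_total : total ge by move=> x y; apply: le_total.
case: (@extremumP A A ge a0 P id le_refl ge_trans ge_total Pa0) => a Pa amax.
by exists a.
Qed.

Lemma total_order_min (P : pred A) a0 : P a0 ->
  exists2 a, P a & forall b, P b -> le a b.
Proof.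
move=> Pa0; case: (@extremumP A A le a0 P id le_refl le_trans le_total Pa0) => a Pa amin.
by exists a.
Qed.

Variables (R : realType) (lo : R) (len : A -> R).
Hypothesis len_gt0 : forall a, 0 < len a.

Local Notation lower := (stacked_lower le lo len).
Local Notation upper := (stacked_upper le lo len).

Lemma upperE a : upper a = lower a + len a.
Proof. by rewrite /stacked_upper (bigD1 a) //= [len a + _]addrC addrA. Qed.

Lemma upper_le_lower a b : le a b -> a != b -> upper a <= lower b.
Proof.
move=> ab nab; rewrite lerD2l; apply: ler_sum_pred => c /=.
  exact: ltW.
move=> ca; rewrite (le_trans ca ab); apply: contra nab => /eqP cb.
by apply/eqP/le_anti; rewrite ab -cb.
Qed.

Lemma upper_max a : (forall b, le b a) -> upper a = lo + \sum_b len b.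
Proof. by move=> amax; congr (_ + _); apply: eq_bigl => b; rewrite amax. Qed.

Lemma lower_min a : (forall b, le a b) -> lower a = lo.
Proof.
move=> amin; rewrite /stacked_lower big_pred0 ?addr0 // => b.
by apply/negP => /andP[ba /eqP]; apply; apply: le_anti; rewrite ba amin.
Qed.

Lemma lo_le_lower a : lo <= lower a.
Proof. by rewrite lerDl; apply: sumr_ge0 => b _; apply: ltW. Qed.

Lemma upper_le_hi a : upper a <= lo + \sum_b len b.
Proof.
by rewrite lerD2l; apply: ler_sum_pred => // b; apply: ltW.
Qed.

Lemma interval_uniq a b z :
  lower a <= z < upper a -> lower b <= z < upper b -> a = b.
Proof.
wlog ab : a b / le a b.
  by move=> H za zb; case/orP: (le_total a b) => ?; [|symmetry]; apply: H.
move=> /andP[_ za] /andP[zb _]; apply/eqP/negPn/negP => /(upper_le_lower ab).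
by rewrite leNgt (le_lt_trans zb za).
Qed.

(** Take the least letter [a] whose upper end exceeds [z]. Its lower end is [lo] or the upper end of
    its predecessor, and by minimality neither exceeds [z]. *)
Lemma interval_exists z : lo <= z < lo + \sum_b len b ->
  exists a, lower a <= z < upper a.
Proof.
move=> /andP[loz zhi].
case: (pickP (fun a : A => true)) => [a0 _|A0]; last first.
  by move: (le_lt_trans loz zhi); rewrite big_pred0 ?addr0 ?ltxx // => a; have := A0 a.
have [m _ mmax] := @total_order_max xpredT a0 isT.
have zm : z < upper m by rewrite upper_max // => b; apply: mmax.
have [a za amin] := @total_order_min (fun a => z < upper a) m zm.
exists a; rewrite za andbT.
case: (pickP (fun b => le b a && (b != a))) => [b0 Pb0|nob]; last first.
  by rewrite /stacked_lower big_pred0 ?addr0.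
(* [b] is the immediate predecessor of [a]. *)
have [b /andP[ba nba] bmax] := @total_order_max (fun b => le b a && (b != a)) b0 Pb0.
have -> : lower a = upper b.
  congr (_ + _); apply: eq_bigl => c; apply/idP/idP => [|cb]; first exact: bmax.
  rewrite (le_trans cb ba) /=; apply: contra nba => /eqP ca.
  by apply/eqP/le_anti; rewrite ba -ca.
rewrite leNgt; apply: contra nba => /amin ab.
by apply/eqP/le_anti; rewrite ba ab.
Qed.

End TotalOrder.

(** * The pieces of an interval exchange, their images and the extreme letters *)

Section Interval.
Variables (R : realType) (A : finType) (T : iet R A).
Implicit Types (a b c : A) (y z : R).

Lemma pieceE a z : piece T a z = (gamma T a <= z < mu T a) :> Prop.
Proof. by rewrite /piece /= in_itv. Qed.

Lemma domainE z : domain T z = (left_end T <= z < right_end T) :> Prop.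
Proof. by rewrite /domain /= in_itv. Qed.

Lemma muE a : mu T a = gamma T a + len T a.
Proof. exact: (upperE (le1_order T)). Qed.

Lemma nuE a : nu T a = delta T a + len T a.
Proof. exact: (upperE (le2_order T)). Qed.

Lemma sub_piece_domain a : piece T a `<=` domain T.
Proof.
move=> z; rewrite pieceE domainE => /andP[az za]; apply/andP; split.
  exact: le_trans (lo_le_lower _ _ (len_gt0 T) a) az.
exact: lt_le_trans za (upper_le_hi _ _ (len_gt0 T) _).
Qed.

Lemma piece_uniq a b z : piece T a z -> piece T b z -> a = b.
Proof.
rewrite !pieceE.
exact: (@interval_uniq _ _ (le1_order T) _ (left_end T) _ (len_gt0 T)).
Qed.

Lemma piece_label z : domain T z -> piece T (label T z) z.
Proof.
rewrite domainE => /(interval_exists (le1_order T))[a za].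
by rewrite pieceE /label; case: pickP => [//|/(_ a)]; rewrite za.
Qed.

Lemma label_piece a z : piece T a z -> label T z = a.
Proof.
by move=> az; apply: (piece_uniq (piece_label (sub_piece_domain az)) az).
Qed.

Lemma piece_nonempty a : piece T a !=set0.
Proof.
by exists (gamma T a); rewrite pieceE lexx muE ltrDl len_gt0.
Qed.

Lemma iet_fun_piece a z : piece T a z -> iet_fun T z = z + nu T a - mu T a.
Proof.
move=> az; rewrite /iet_fun (label_piece az).
by have := sub_piece_domain az; rewrite domainE => ->.
Qed.

Lemma image_pieceE a : iet_fun T @` piece T a = `[delta T a, nu T a[.
Proof.
apply/seteqP; split => y /=.
  move=> [z az <-]; rewrite (iet_fun_piece az) in_itv /=.
  move: az; rewrite pieceE muE nuE => /andP[az za]; apply/andP; split; lra.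
(* On [I_a] the map is the translation by [nu - mu], which equals [delta - gamma]; the witness
   undoes it. *)
rewrite in_itv /= nuE => /andP[ay ya]; exists (y - delta T a + gamma T a).
  by rewrite pieceE muE; apply/andP; split; lra.
rewrite (@iet_fun_piece a); first by rewrite muE nuE; ring.
by rewrite pieceE muE; apply/andP; split; lra.
Qed.

(** The images are stacked in the order [le2]. This plays the part of injectivity of [T] below. *)
Lemma image_piece_uniq a b y :
  (iet_fun T @` piece T a) y -> (iet_fun T @` piece T b) y -> a = b.
Proof.
rewrite !image_pieceE /= !in_itv /=.
exact: (@interval_uniq _ _ (le2_order T) _ (left_end T) _ (len_gt0 T)).
Qed.

Lemma iet_fun_domain z : domain T z -> domain T (iet_fun T z).
Proof.
move=> /piece_label az; have : (iet_fun T @` piece T (label T z)) (iet_fun T z).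
  by exists z.
rewrite image_pieceE /= in_itv domainE /= => /andP[ay ya]; apply/andP; split.
  exact: le_trans (lo_le_lower _ _ (len_gt0 T) _) ay.
exact: lt_le_trans ya (upper_le_hi _ _ (len_gt0 T) _).
Qed.

Lemma largest_letterP (le : rel A) : total_order le ->
  forall b, le b (largest_letter T le).
Proof.
move=> leP b; rewrite /largest_letter; case: pickP => [a /forallP//|noa].
have [m _ mmax] := total_order_max leP (isT : xpredT b).
by have /forallP[] := noa m => c; apply: mmax.
Qed.

Lemma smallest_letterP (le : rel A) : total_order le ->
  forall b, le (smallest_letter T le) b.
Proof.
move=> leP b; rewrite /smallest_letter; case: pickP => [a /forallP//|noa].
have [m _ mmin] := total_order_min leP (isT : xpredT b).
by have /forallP[] := noa m => c; apply: mmin.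
Qed.

Lemma mu_largest : mu T (largest_letter T (le1 T)) = right_end T.
Proof. exact/upper_max/largest_letterP/le1_order. Qed.

Lemma nu_largest : nu T (largest_letter T (le2 T)) = right_end T.
Proof. exact/upper_max/largest_letterP/le2_order. Qed.

Lemma gamma_smallest : gamma T (smallest_letter T (le1 T)) = left_end T.
Proof. exact/(lower_min (le1_order T))/smallest_letterP/le1_order. Qed.

Lemma delta_smallest : delta T (smallest_letter T (le2 T)) = left_end T.
Proof. exact/(lower_min (le2_order T))/smallest_letterP/le2_order. Qed.

End Interval.

(** * Recoding orbits of [T] by orbits of an induced map *)

Section Recoding.
Variables (R : realType) (A : finType).
Implicit Types (T S : iet R A) (E : set R) (a b c : A) (z : R).

(** The words [w] are read along the [T]-orbits that realize one step of [S]. *)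
Definition recodes T S (w : A -> seq A) : Prop :=
  domain S `<=` domain T /\
  forall z, domain S z -> let v := w (label S z) in
    map (label T) (traject (iet_fun T) z (size v)) = v /\
    iter (size v) (iet_fun T) z = iet_fun S z.

(** [S] preserves its domain, so the words of successive steps can be concatenated. *)
Lemma recodes_traject T S w n z : recodes T S w -> domain S z ->
  let v := flatten (map w (map (label S) (traject (iet_fun S) z n))) in
  map (label T) (traject (iet_fun T) z (size v)) = v /\
  iter (size v) (iet_fun T) z = iter n (iet_fun S) z.
Proof.
move=> [_ TS]; elim: n z => [|n IHn] z Sz //=.
have [vE nE] := TS z Sz; have [vsE nsE] := IHn _ (iet_fun_domain Sz).
rewrite size_cat addnC iterD nE nsE -iterSr; split => //.
by rewrite addnC trajectD map_cat vE nE vsE.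
Qed.

(** One step of [S] is a run of steps of [T'] labelled by a word of [w']; each of these expands by
    [w]. *)
Lemma recodes_trans T T' S w w' : recodes T T' w -> recodes T' S w' ->
  recodes T S (fun a => flatten (map w (w' a))).
Proof.
move=> TT' [ST' T'S]; split; first exact: subset_trans ST' TT'.1.
move=> z Sz; have [vE nE] := T'S z Sz.
have := recodes_traject (size (w' (label S z))) TT' (ST' z Sz).
by rewrite vE nE.
Qed.

(** The first [n.+1] letters of the coding by [S] expand to a prefix of the coding by [T] that has
    more than [n] letters, hence contains the entry of index [n]. *)
Lemma recodes_coding T S (theta : {multiplicative free_group A -> free_group A}) z :
  positive_automorphism theta -> recodes T S (letter_image theta) ->
  domain S z -> coding T z = apply_inf theta (coding S z).
Proof.
move=> thetaP TS Sz; apply/funext => n; rewrite /apply_inf.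
have -> : [seq letter_image theta (coding S z i) | i <- iota 0 n.+1] =
    map (letter_image theta) (map (label S) (traject (iet_fun S) z n.+1)).
  rewrite map_comp; congr map; apply: (@eq_from_nth _ (label S z)).
    by rewrite !size_map size_iota size_traject.
  move=> i; rewrite size_map size_iota => i_lt.
  rewrite (nth_map 0%N) ?size_iota // nth_iota //.
  by rewrite (nth_map z) ?size_traject // nth_traject.
have [vE _] := recodes_traject n.+1 TS Sz.
have : (n < size (map (label S) (traject (iet_fun S) z n.+1)))%N.
  by rewrite size_map size_traject.
move=> /leq_trans/(_ (leq_size_letter_images _ thetaP)).
move: vE; set v := flatten _ => vE nv.
by rewrite -vE (nth_map z) ?size_traject // nth_traject.
Qed.

Lemma first_return1 T E z n : first_return T E z n ->
  E (iet_fun T z) -> n = 1%N.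
Proof.
case: n => [|[|n]] [] // _ _ /(_ 1%N isT) /= nE E1.
by have := nE E1.
Qed.

Lemma first_return2 T E z n : first_return T E z n ->
  ~ E (iet_fun T z) -> E (iet_fun T (iet_fun T z)) -> n = 2%N.
Proof.
case: n => [|[|[|n]]] [] // _ _.
by move=> /(_ 2%N isT) /= nE _ E2; have := nE E2.
Qed.

(** Points of [I_b] leave [E] for one step, which they spend in [I_a]. *)
Lemma recodes_append T E S a b : E `<=` domain T -> is_induced T E S -> a != b ->
    (forall y, domain T y -> E y <-> ~ (iet_fun T @` piece T b) y) ->
    iet_fun T @` piece T b `<=` piece T a ->
    (forall c, piece S c = piece T c `&` E) ->
  recodes T S (fun c => if c == b then [:: b; a] else [:: c]).
Proof.
move=> ET [SE ind] /eqP ab EJ Ja pS; rewrite /recodes SE; split => // z Ez.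
have Tz := ET z Ez; have TTz := iet_fun_domain Tz.
have := Ez; rewrite -{1}SE => /piece_label; rewrite pS => -[cz _].
have [n ret ->] := ind z Ez; case: eqP cz => [->|cb] cz /=; last first.
  rewrite (label_piece cz) (first_return1 ret) //.
  by apply/(EJ _ TTz) => Jb; apply: cb; apply: (image_piece_uniq _ Jb); exists z.
have Jb : (iet_fun T @` piece T b) (iet_fun T z) by exists z.
rewrite (label_piece cz) (label_piece (Ja _ Jb)) (first_return2 ret) //.
  by move/(EJ _ TTz).
(* The second iterate lies in [T(I_a)]; were it outside [E], it would also lie in [T(I_b)]. *)
apply/(EJ _ (iet_fun_domain TTz)) => Jb2; apply: ab.
by apply: (image_piece_uniq _ Jb2); exists (iet_fun T z) => //; apply: Ja.
Qed.

(** Here the [S]-label of [z] is the [T]-label of the last point before the return. A return at once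
    gives the label of [z], which is not [a] as [z] lies in [E]. Otherwise the intermediate point
    lies in [I_a], so the label is [a], and [z] lies in [I_b] because [I_a] is inside [T(I_b)]. *)
Lemma recodes_prepend T E S a b : E `<=` domain T -> is_induced T E S -> a != b ->
    (forall y, domain T y -> E y <-> ~ piece T a y) ->
    piece T a `<=` iet_fun T @` piece T b ->
    (forall c, piece S c =
       E `&` (iet_fun S @^-1` ((iet_fun T @` piece T c) `&` E))) ->
  recodes T S (fun c => if c == a then [:: b; a] else [:: c]).
Proof.
move=> ET [SE ind] /eqP ab EI Ia pS; rewrite /recodes SE; split => // z Ez.
have Tz := ET z Ez; have TTz := iet_fun_domain Tz.
have := Ez; rewrite -{1}SE => /piece_label; rewrite pS => -[_ [/= cSz _]].
have [n ret Sz] := ind z Ez; rewrite Sz in cSz *.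
have cz := piece_label Tz.
have cTz : (iet_fun T @` piece T (label T z)) (iet_fun T z) by exists z.
case: (pselect (E (iet_fun T z))) => [E1|nE1].
  have n1 := first_return1 ret E1; rewrite n1 /= in cSz *.
  rewrite (image_piece_uniq cSz cTz); case: eqP => [ca|_] //=.
  by case: ((EI _ Tz).1 Ez); rewrite -ca.
have az : piece T a (iet_fun T z) by apply: contrapT => na; apply/nE1/(EI _ TTz).
have aTz : (iet_fun T @` piece T a) (iet_fun T (iet_fun T z)).
  by exists (iet_fun T z).
(* A second iterate outside [E] would lie in [I_a], hence in both [T(I_a)] and [T(I_b)]. *)
have n2 : n = 2%N.
  apply: first_return2 ret nE1 _; apply/(EI _ (iet_fun_domain TTz)).
  by move=> /Ia /(image_piece_uniq aTz).
rewrite n2 /= in cSz *; rewrite (image_piece_uniq cSz aTz) eqxx /=.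
by rewrite (label_piece az) (image_piece_uniq cTz (Ia _ az)).
Qed.

(** * Automorphisms attached to Rauzy inductions *)

Definition recoding_automorphism T S : Prop :=
  exists2 theta : {multiplicative free_group A -> free_group A},
    positive_automorphism theta & recodes T S (letter_image theta).

Lemma recoding_append T S a b : a != b ->
  recodes T S (fun c => if c == b then [:: b; a] else [:: c]) ->
  recoding_automorphism T S.
Proof.
move=> /append_automorphism[theta thetaP thetaE] TS.
by exists theta => //; rewrite (funext thetaE).
Qed.

Lemma recoding_prepend T S a b : a != b ->
  recodes T S (fun c => if c == a then [:: b; a] else [:: c]) ->
  recoding_automorphism T S.
Proof.
move=> /prepend_automorphism[theta thetaP thetaE] TS.
by exists theta => //; rewrite (funext thetaE).
Qed.

(** If the two endpoints coincide then [K_b] is empty, against [len_gt0]. *)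
Lemma psi_recoding T S : is_psi T S -> recoding_automorphism T S.
Proof.
rewrite /is_psi.
have := mu_largest T; have := nu_largest T.
move: (largest_letter T (le1 T)) (largest_letter T (le2 T)) => a b nub mua.
have la := muE T a; have lb := nuE T b; rewrite mua in la; rewrite nub in lb.
have a0 := len_gt0 T a; have b0 := len_gt0 T b.
set E := [set` _]; move=> [ind pS].
have ET : E `<=` domain T.
  move=> z; rewrite domainE /E /= in_itv /= => /andP[-> /=]; rewrite lt_max => /orP[]; lra.
case: (ltgtP (gamma T a) (delta T b)) => gd in pS.
(* [I_a] and [T(I_b)] both end at the right end of the domain, so [a = b] would give them equal
   lengths and the same left endpoint. *)
- have ab : a != b by apply/eqP => ab; move: gd; rewrite ab in la *; lra.
  apply: (recoding_append ab); apply: (recodes_append ET ind ab) => //.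
    move=> y; rewrite domainE image_pieceE /E /= !in_itv /= nub (max_r (ltW gd)).
    move=> /andP[-> ->]; rewrite andbT /= ltNge; by split => [/negP|/negP].
  move=> y; rewrite image_pieceE /= in_itv pieceE /= nub mua => /andP[dy ->].
  by rewrite andbT; lra.
- have ab : a != b by apply/eqP => ab; move: gd; rewrite ab in la *; lra.
  apply: (recoding_prepend ab); apply: (recodes_prepend ET ind ab) => //.
    move=> y; rewrite domainE pieceE /E /= !in_itv /= mua (max_l (ltW gd)).
    move=> /andP[-> ->]; rewrite andbT /= ltNge; by split => [/negP|/negP].
  move=> y; rewrite image_pieceE /= in_itv pieceE /= nub mua => /andP[dy ->].
  by rewrite andbT; lra.
- have [z] := piece_nonempty S b; rewrite pS => -[_ []].
  rewrite image_pieceE /E /= !in_itv /= gd maxxx => /andP[dz _] /andP[_].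
  by rewrite ltNge dz.
Qed.

(** Mirror image of the right induction: [I_a] and [T(I_b)] now share the left end of the domain,
    for the smallest letters [a] and [b], and the shorter one is removed. Equal endpoints again
    leave [K_b] empty. *)
Lemma phi_recoding T S : is_phi T S -> recoding_automorphism T S.
Proof.
rewrite /is_phi.
have := gamma_smallest T; have := delta_smallest T.
move: (smallest_letter T (le1 T)) (smallest_letter T (le2 T)) => a b db ga.
have la := muE T a; have lb := nuE T b; rewrite ga in la; rewrite db in lb.
have a0 := len_gt0 T a; have b0 := len_gt0 T b.
set E := [set` _]; move=> [ind pS].
have ET : E `<=` domain T.
  move=> z; rewrite domainE /E /= in_itv /= => /andP[+ ->]; rewrite ge_min => /orP[]; lra.
case: (ltgtP (nu T b) (mu T a)) => nm in pS.
- have ab : a != b by apply/eqP => ab; move: nm; rewrite ab in la *; lra.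
  apply: (recoding_append ab); apply: (recodes_append ET ind ab) => //.
    move=> y; rewrite domainE image_pieceE /E /= !in_itv /= db (min_r (ltW nm)).
    move=> /andP[-> ->]; rewrite andbT /= leNgt; by split => [/negP|/negP].
  move=> y; rewrite image_pieceE /= in_itv pieceE /= db ga => /andP[-> yn].
  by rewrite /=; lra.
- have ab : a != b by apply/eqP => ab; move: nm; rewrite ab in la *; lra.
  apply: (recoding_prepend ab); apply: (recodes_prepend ET ind ab) => //.
    move=> y; rewrite domainE pieceE /E /= !in_itv /= ga (min_l (ltW nm)).
    move=> /andP[-> ->]; rewrite andbT /= leNgt; by split => [/negP|/negP].
  move=> y; rewrite image_pieceE /= in_itv pieceE /= db ga => /andP[-> yn].
  by rewrite /=; lra.
- have [z] := piece_nonempty S b; rewrite pS => -[_ []].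
  rewrite image_pieceE /E /= !in_itv /= nm minxx => /andP[_ zn] /andP[+ _].
  by rewrite leNgt zn.
Qed.

(** The head of [chi] acts last, so its automorphism [k], from [S] to [T'], is applied before the
    automorphism [h] from [T'] to [T]. The empty word gives the identity. *)
Lemma rauzy_recoding chi T S : is_rauzy chi T S -> recoding_automorphism T S.
Proof.
elim: chi S => [|c chi IHchi] S /=.
  move=> ->; exists (idfun : {multiplicative free_group A -> free_group A}).
    by split; [exists idfun|].
  by split.
move=> [T' /IHchi[h hP hT] T'S].
have [k kP kS] : recoding_automorphism T' S.
  by case: c T'S; [apply: phi_recoding|apply: psi_recoding].
exists (h \o k : {multiplicative free_group A -> free_group A}).
  exact: positive_automorphism_comp.
have -> : letter_image (h \o k) =
    fun a => flatten (map (letter_image h) (letter_image k a)).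
  by apply/funext => a; apply: letter_image_comp.
exact: recodes_trans hT kS.
Qed.

End Recoding.

Theorem theorem4p15 (R : realType) (A : finType) (T : iet R A)
    (Treg : regular T) (chi : seq rauzy) (S : iet R A)
    (ST : is_rauzy chi T S) :
  exists theta : {multiplicative free_group A -> free_group A},
    positive_automorphism theta /\
    forall z : R, domain S z -> coding T z = apply_inf theta (coding S z).
Proof.
have [theta thetaP TS] := rauzy_recoding ST.
by exists theta; split => // z; apply: recodes_coding.
Qed.
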